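(* Let $X(T)=\{X_t \mid t\in T\}$ be a P-divisible stochastic process with finite state space $\mathbb{E}=\{0,1,\ldots,d-1\}$ and transition matrices $T(t,t')$ (as defined in the context). Let $m\ge 3$, let $t_1\le t_2\le\cdots\le t_m$ be time instants in $T$, and assume $P\{X_{t_1}=j\}>0$ for every $j\in\mathbb{E}$. Let $R=S_0,S_1,\ldots,S_{m-2}$ be the one-step transition matrices and $Q_r^{(k_r:\cdots:k_1)}$ ($1\le r\le m-2$, $k_1,\ldots,k_r\in\{1,\ldots,d\}$) the memory transition matrices of the process along $t_1,\ldots,t_m$, and let $H_{n,r}^{(k_r:\cdots:k_1)}$ be the matrices built from them, all as defined in the context. Then for every $n\in\{3,\ldots,m\}$ and every $k\in\{1,\ldots,d\}$, $$H_{n,1}^{(k)}\,\mathbf{c}_k^{R}=S_{n-2}S_{n-3}\cdots S_1\,\mathbf{c}_k^{R}.$$ Explicitly, for $n=3$ this is $Q_1^{(k)}\mathbf{c}_k^R=S_1\mathbf{c}_k^R$; for $n=4$ it is $$\Big[\,Q_2^{(1:k)}\mathbf{c}_1^{Q_1^{(k)}}\ \Big|\ \cdots\ \Big|\ Q_2^{(d:k)}\mathbf{c}_d^{Q_1^{(k)}}\Big]\,\mathbf{c}_k^R=S_2S_1\mathbf{c}_k^R;$$ and for $n=5$ it is $$\Big[\,G_3^{(1:k)}\mathbf{c}_1^{Q_1^{(k)}}\ \Big|\ \cdots\ \Big|\ G_3^{(d:k)}\mathbf{c}_d^{Q_1^{(k)}}\Big]\,\mathbf{c}_k^R=S_3S_2S_1\mathbf{c}_k^R,$$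 where $$G_3^{(i:k)}=\Big[\,Q_3^{(1:i:k)}\mathbf{c}_1^{Q_2^{(i:k)}}\ \Big|\ \cdots\ \Big|\ Q_3^{(d:i:k)}\mathbf{c}_d^{Q_2^{(i:k)}}\Big].$$
   Context: Process. $T=\{t_0,t_1,\ldots\}$ is a set of discrete times, and $X(T)$ is a family of random variables $X_t$, $t\in T$, on a common probability space with finite sample space, with values in $\mathbb{E}=\{0,1,\ldots,d-1\}$, $d\ge 1$. No Markov property is assumed. (In the claim, $t_1\le\cdots\le t_m$ denotes an arbitrary ordered choice of elements of the time set.) Rows and columns of $d\times d$ matrices are indexed by $1,\ldots,d$, and index $i$ corresponds to the state $i-1\in\mathbb{E}$. Transition matrices and P-divisibility. A family of transition matrices of $X(T)$ is a family of real $d\times d$ matrices $T(t,t')$, $t\ge t'$ in $T$, with: (1) nonnegative entries; (2) each column summing to $1$; (3) $T(t',t')=I$; (4) $P\{X_t=a-1,\,X_{t'}=b-1\}=T_{ab}(t,t')\,P\{X_{t'}=b-1\}$ for all $a,b$. Thus $T_{ab}(t,t')$ is the conditional probability $P\{X_t=a-1\mid X_{t'}=b-1\}$ whenever the conditioning event has positive probability. The process with these transition matrices is called P-divisible if the Chapman–Kolmogorov equation $T(t,t')=T(t,s)\,T(s,t')$ holds for all $t\ge s\ge t'$ in $T$. One-step matrices. For times $t_1\le\cdots\le t_m$ put $S_{r}:=T(t_{r+2},t_{r+1})$ for $0\le r\le m-2$, and $R:=S_0=T(t_2,t_1)$. Memory transition matrices. For $1\le r\le m-2$ and $k_1,\ldots,k_r\in\{1,\ldots,d\}$,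 $Q_r^{(k_r:\cdots:k_1)}$ is the $d\times d$ matrix whose $(v,l)$ entry is the conditional probability $$P\{X_{t_{r+2}}=v-1\mid X_{t_{r+1}}=l-1,\ X_{t_r}=k_r-1,\ldots,X_{t_1}=k_1-1\}.$$ If the conditioning event has probability zero, the entry may be any fixed real number in $[0,1]$. Notation. For a matrix $M$, $\mathbf{c}_j^{M}$ denotes its $j$-th column, as a column vector. $[\,v_1\mid\cdots\mid v_d\,]$ denotes the matrix with columns $v_1,\ldots,v_d$. The matrices $H$. For fixed $n\in\{3,\ldots,m\}$ define $d\times d$ matrices $H_{n,r}^{(k_r:\cdots:k_1)}$, $1\le r\le n-2$, by downward recursion on $r$: $$H_{n,n-2}^{(k_{n-2}:\cdots:k_1)}:=Q_{n-2}^{(k_{n-2}:\cdots:k_1)},$$ and for $1\le r<n-2$, $H_{n,r}^{(k_r:\cdots:k_1)}$ is the matrix whose $j$-th column is $$H_{n,r+1}^{(j:k_r:\cdots:k_1)}\,\mathbf{c}_j^{\,Q_r^{(k_r:\cdots:k_1)}},\qquad j=1,\ldots,d.$$ *)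

(* Defs.v *)
From HB Require Import structures.
From mathcomp Require Import all_boot all_order all_algebra.
From mathcomp Require Import all_classical all_reals all_analysis.

Set Implicit Arguments.
Unset Strict Implicit.
Unset Printing Implicit Defensive.

Import Order.TTheory GRing.Theory Num.Theory.
Local Open Scope classical_set_scope.
Local Open Scope ring_scope.

(* Conventions.
   - The state space {0, ..., d-1} sits inside nat: the variables of the process
     are nat-valued random variables bounded by d.
   - Rows and columns of d x d matrices are indexed by 'I_d = {0, ..., d-1}, so
     the row or column i (counted from 0) corresponds to the state i.
   - Times t_1, ..., t_m are given by t : nat -> TT, keeping the numbering from 1;
     t 0 and t i for i > m play no role.
   - A memory (k_r : ... : k_1) is the r-tuple [tuple k_r; ...; k_1]: the most
     recent state comes first. *)

Section Process.
Context {dO : measure_display} {Omega : measurableType dO} {R : realType}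
  (P : probability Omega R) {disp : Order.disp_t} {TT : orderType disp}
  {d : nat}.
Implicit Types (X : TT -> {RV P >-> nat}) (Tr : TT -> TT -> 'M[R]_d)
  (t : nat -> TT).

Definition pr (A : set Omega) : R := fine (P A).

Record transition_matrices X Tr : Prop := TransitionMatrices {
  trans_ge0 : forall u u' (a b : 'I_d), (u' <= u)%O -> 0 <= Tr u u' a b;
  trans_col : forall u u' (b : 'I_d), (u' <= u)%O -> \sum_a Tr u u' a b = 1;
  trans_id  : forall u, Tr u u = 1%:M;
  trans_pr  : forall u u' (a b : 'I_d), (u' <= u)%O ->
    pr [set w | X u w = a /\ X u' w = b] =
      Tr u u' a b * pr [set w | X u' w = b] }.

Definition P_divisible Tr : Prop :=
  forall u s u', (u' <= s)%O -> (s <= u)%O -> Tr u u' = Tr u s *m Tr s u'.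

Definition one_step Tr t (r : nat) : 'M[R]_d := Tr (t r.+2) (t r.+1).

(* {X_{t_{r+1}} = l, X_{t_r} = k_r, ..., X_{t_1} = k_1}; with the most recent
   state first, k_{i+1} is the entry of ks at position r - (i+1) = rev_ord i. *)
Definition past_event X t r (ks : r.-tuple 'I_d) (l : 'I_d) : set Omega :=
  [set w | X (t r.+1) w = l /\
           forall i : 'I_r, X (t i.+1) w = tnth ks (rev_ord i)].

(* Entries whose conditioning event is null are only constrained to lie in
   [0, 1]. *)
Definition memory_matrices X t (m : nat)
    (Q : forall r, r.-tuple 'I_d -> 'M[R]_d) : Prop :=
  forall r, (1 <= r <= m - 2)%N -> forall (ks : r.-tuple 'I_d) (v l : 'I_d),
    let C := past_event X t ks l in
    (pr C != 0 -> Q r ks v l = pr ([set w | X (t r.+2) w = v] `&` C) / pr C) /\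
    (pr C = 0 -> 0 <= Q r ks v l <= 1).

End Process.

Section MemoryProducts.
Context {R : realType} {d : nat}.
Implicit Type Q : forall r, r.-tuple 'I_d -> 'M[R]_d.

(* [ c 0 | ... | c (d-1) ] *)
Definition mx_of_cols (c : 'I_d -> 'cV[R]_d) : 'M[R]_d :=
  \matrix_(v, j) c j v 0.

(* The downward recursion on r, run on f = n - 2 - r. *)
Fixpoint memory_H_rec Q (f r : nat) (ks : r.-tuple 'I_d) {struct f} : 'M[R]_d :=
  if f is f'.+1 then
    mx_of_cols (fun j => memory_H_rec Q f' [tuple of j :: ks] *m col j (Q r ks))
  else Q r ks.

(* Meaningful for 1 <= r <= n - 2. *)
Definition memory_H Q (n r : nat) (ks : r.-tuple 'I_d) : 'M[R]_d :=
  memory_H_rec Q (n - 2 - r) ks.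

End MemoryProducts.

(* Main.v *)
Require Import Defs.
From HB Require Import structures.
From mathcomp Require Import all_boot all_order all_algebra.
From mathcomp Require Import all_classical all_reals all_analysis.

Set Implicit Arguments.
Unset Strict Implicit.
Unset Printing Implicit Defensive.

Import Order.TTheory GRing.Theory Num.Theory.
Local Open Scope classical_set_scope.
Local Open Scope ring_scope.

(* For a fixed history k_1, ..., k_r, multiplying H_{n,r} by the vector of joint
   probabilities P{X_{t_{r+1}} = l, X_{t_r} = k_r, ..., X_{t_1} = k_1} sums out
   all states between t_r and t_n (chain rule for conditional probabilities), so
   it yields P{X_{t_n} = v, X_{t_r} = k_r, ..., X_{t_1} = k_1}. For r = 1 and
   after division by P{X_{t_1} = k}, this is the k-th column of T(t_n, t_1),
   which Chapman-Kolmogorov factors as S_{n-2} ... S_1 R. *)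

Section ProcessLemmas.
Context {dO : measure_display} {Omega : measurableType dO} {R : realType}
  (P : probability Omega R) {disp : Order.disp_t} {TT : orderType disp}
  {d : nat}.
Implicit Types (X : TT -> {RV P >-> nat}) (Tr : TT -> TT -> 'M[R]_d)
  (t : nat -> TT) (A : set Omega).

(** Separated from [past_event] so that the state at [t r.+1] stays free and can be summed out. *)
Definition history X t r (ks : r.-tuple 'I_d) : set Omega :=
  [set w | forall i : 'I_r, X (t i.+1) w = tnth ks (rev_ord i)].

Lemma measurable_RV_eq (X : {RV P >-> nat}) (v : nat) :
  measurable [set w | X w = v].
Proof.
rewrite (_ : [set w | _] = setT `&` X @^-1` [set v]); first exact: measurable_funPT.
by rewrite setTI.
Qed.

Lemma measurable_history X t r (ks : r.-tuple 'I_d) :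
  measurable (history X t ks).
Proof.
rewrite (_ : history _ _ _ =
  \bigcap_(i in [set: 'I_r]) [set w | X (t i.+1) w = tnth ks (rev_ord i)]).
  by apply: fin_bigcap_measurable => // i _; exact: measurable_RV_eq.
by apply/seteqP; split => w /= h i; [move=> _|]; exact: h.
Qed.

Lemma past_eventE X t r (ks : r.-tuple 'I_d) (l : 'I_d) :
  past_event X t ks l = [set w | X (t r.+1) w = l] `&` history X t ks.
Proof. by []. Qed.

Lemma measurable_past_event X t r (ks : r.-tuple 'I_d) (l : 'I_d) :
  measurable (past_event X t ks l).
Proof.
rewrite past_eventE; apply: measurableI; first exact: measurable_RV_eq.
exact: measurable_history.
Qed.

(** Since the most recent state comes first, [rev_ord] pairs the last time with the head [l], and
    each earlier time keeps its entry of [ks], one position further on. This lets the induction on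
    the recursion depth lengthen the memory. *)
Lemma history_cons X t r (ks : r.-tuple 'I_d) (l : 'I_d) :
  history X t [tuple of l :: ks] = past_event X t ks l.
Proof.
apply/seteqP; split => w /=.
  move=> h; split.
    have := h ord_max; rewrite (_ : rev_ord _ = ord0) ?tnth0 //.
    by apply: val_inj; rewrite /= subnn.
  move=> i; have := h (widen_ord (leqnSn r) i) => /= ->.
  rewrite -(tnthS l ks); congr (nat_of_ord (tnth _ _)); apply: val_inj => /=.
  by rewrite /bump /= add1n -subSn.
case=> hl h i; case: (unliftP ord_max i) => [j ->|->].
  rewrite lift_max h -(tnthS l ks); congr (nat_of_ord (tnth _ _)).
  apply: val_inj => /=.
  by rewrite /bump [(r <= j)%N]leqNgt ltn_ord add0n add1n -subSn.
rewrite /= hl (_ : rev_ord _ = ord0) ?tnth0 //.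
by apply: val_inj; rewrite /= subnn.
Qed.

Lemma history1 X t (k : 'I_d) :
  history X t [tuple k] = [set w | X (t 1%N) w = k].
Proof.
apply/seteqP; split => w /= h; first exact: (h ord0).
by move=> i; rewrite !ord1.
Qed.

Lemma pr_ge0 A : 0 <= pr P A.
Proof. exact/fine_ge0/measure_ge0. Qed.

Lemma le_pr A B : measurable A -> measurable B -> A `<=` B -> pr P A <= pr P B.
Proof.
move=> mA mB AB; apply: fine_le; [exact: fin_num_measure..|].
by apply: le_measure => //; rewrite inE.
Qed.

Lemma pr_total A (Y : {RV P >-> nat}) : measurable A -> (forall w, (Y w < d)%N) ->
  pr P A = \sum_(l < d) pr P (A `&` [set w | Y w = l]).
Proof.
move=> mA Y_lt; pose F (l : nat) := A `&` [set w | Y w = l].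
have mF l : measurable (F l) by apply: measurableI => //; exact: measurable_RV_eq.
have {1}-> : A = \big[setU/set0]_(l < d) F l.
  rewrite -bigcup_mkord; apply/seteqP; split => w /=.
    by move=> Aw; exists (Y w) => //=; exact: Y_lt.
  by case=> l _ [].
rewrite {1}/pr measure_bigsetU //.
  by rewrite sum_fine // => l _; apply: fin_num_measure; exact: mF.
apply/trivIsetP => i j _ _ /eqP ij; apply/seteqP; split => // w.
by case=> -[_ /= Yi] [_ /= Yj]; apply: ij; rewrite -Yi.
Qed.

(* When the conditioning event is null, Q is arbitrary but both sides vanish. *)
Lemma memory_step X t m Q r (ks : r.-tuple 'I_d) (v l : 'I_d) :
  memory_matrices X t m Q -> (1 <= r <= m - 2)%N ->
  Q r ks v l * pr P (past_event X t ks l) =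
  pr P ([set w | X (t r.+2) w = v] `&` past_event X t ks l).
Proof.
move=> Q_mem r_m; have [hne _] := Q_mem r r_m ks v l.
have [C0|Cn0] := eqVneq (pr P (past_event X t ks l)) 0; last first.
  by rewrite hne // divfK.
rewrite C0 mulr0; apply/esym/eqP; rewrite eq_le pr_ge0 andbT -C0.
apply: le_pr; last exact: subIsetr.
  apply: measurableI; first exact: measurable_RV_eq.
  exact: measurable_past_event.
exact: measurable_past_event.
Qed.

(** Induction on [f] with [r] and [ks] general, because each recursive call prepends a state to the
    memory. *)
Lemma memory_H_rec_pr X t m Q f r (ks : r.-tuple 'I_d) (v : 'I_d) :
  (forall u w, (X u w < d)%N) -> memory_matrices X t m Q ->
  (1 <= r)%N -> (r + f <= m - 2)%N ->
  \sum_l memory_H_rec Q f ks v l * pr P (past_event X t ks l) =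
  pr P ([set w | X (t (r + f).+2) w = v] `&` history X t ks).
Proof.
move=> X_lt Q_mem; elim: f r ks => [|f IH] r ks r_gt0 rf_m.
  rewrite addn0 in rf_m *.
  under eq_bigr => l _ do rewrite (memory_step _ _ _ Q_mem) ?r_gt0 //.
  rewrite (pr_total _ (X_lt (t r.+1))); last first.
    by apply: measurableI; [exact: measurable_RV_eq|exact: measurable_history].
  by apply: eq_bigr => l _; rewrite past_eventE setIA setIAC.
have r_m : (r <= m - 2)%N by apply: leq_trans rf_m; exact: leq_addr.
rewrite addnS -addSn (pr_total _ (X_lt (t r.+1))); last first.
  by apply: measurableI; [exact: measurable_RV_eq|exact: measurable_history].
apply: eq_bigr => l _ /=.
(* Fixing X_{t_{r+1}} = l turns the event into a history of length [r.+1], to which the induction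
   hypothesis applies. *)
rewrite -setIA (setIC (history _ _ _)) -past_eventE -history_cons -IH //; last first.
  by rewrite addSn -addnS.
rewrite !mxE mulr_suml; apply: eq_bigr => i _.
(* The entry of column [l] of [Q r ks] times the probability of its conditioning event is the joint
   probability weighting the longer memory. *)
rewrite !mxE -mulrA history_cons (memory_step _ _ _ Q_mem) ?r_gt0 //.
by rewrite [in RHS]past_eventE history_cons.
Qed.

(** Chapman-Kolmogorov telescopes: the leftmost factor is the latest step, and peeling it off leaves
    the product up to the time before. *)
Lemma one_step_prod Tr t (m k : nat) : P_divisible Tr ->
  (forall i j, (1 <= i)%N -> (i <= j)%N -> (j <= m)%N -> (t i <= t j)%O) ->
  (k.+2 <= m)%N ->
  (\big[mulmx/1%:M]_(i < k) one_step Tr t (k - i)) *m one_step Tr t 0 =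
  Tr (t k.+2) (t 1%N).
Proof.
move=> Tr_div t_le; elim: k => [|k IH] k_m; first by rewrite big_ord0 mul1mx.
rewrite big_ord_recl subn0 -mulmxA.
under eq_bigr => i _ do rewrite lift0 subSS.
rewrite IH; last exact: ltnW.
by rewrite -Tr_div //; apply: t_le => //; exact: ltnW.
Qed.

Lemma trans_cond_pr X Tr (u u' : TT) (a b : 'I_d) : transition_matrices X Tr ->
  (u' <= u)%O -> pr P [set w | X u' w = b] != 0 ->
  Tr u u' a b = pr P [set w | X u w = a /\ X u' w = b] / pr P [set w | X u' w = b].
Proof. by move=> X_Tr u'u b0; rewrite (trans_pr X_Tr) // mulfK. Qed.

End ProcessLemmas.

Theorem corollary1
  (R : realType) (dO : measure_display) (Omega : measurableType dO)
  (P : probability Omega R) (Omega_fin : finite_set [set: Omega])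
  (disp : Order.disp_t) (TT : orderType disp)
  (d : nat) (d_ge1 : (1 <= d)%N)
  (X : TT -> {RV P >-> nat}) (X_lt : forall u w, (X u w < d)%N)
  (Tr : TT -> TT -> 'M[R]_d) (X_Tr : transition_matrices X Tr)
  (Tr_div : P_divisible Tr)
  (m : nat) (m_ge3 : (3 <= m)%N)
  (t : nat -> TT)
  (t_le : forall i j, (1 <= i)%N -> (i <= j)%N -> (j <= m)%N -> (t i <= t j)%O)
  (X1_gt0 : forall j : 'I_d, 0 < pr P [set w | X (t 1%N) w = j])
  (Q : forall r, r.-tuple 'I_d -> 'M[R]_d)
  (Q_mem : memory_matrices X t m Q) :
  let S := one_step Tr t in
  let R0 := S 0%N in
  let G3 := fun i k : 'I_d =>
    mx_of_cols (fun j => Q 3%N [tuple j; i; k] *m col j (Q 2%N [tuple i; k])) in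
  [/\ (forall n, (3 <= n <= m)%N -> forall k : 'I_d,
         memory_H Q n [tuple k] *m col k R0 =
         (\big[mulmx/1%:M]_(i < n - 2) S (n - 2 - i)%N) *m col k R0),
      (forall k : 'I_d, Q 1%N [tuple k] *m col k R0 = S 1%N *m col k R0),
      ((4 <= m)%N -> forall k : 'I_d,
         mx_of_cols (fun j => Q 2%N [tuple j; k] *m col j (Q 1%N [tuple k]))
           *m col k R0 = S 2%N *m S 1%N *m col k R0) &
      ((5 <= m)%N -> forall k : 'I_d,
         mx_of_cols (fun i => G3 i k *m col i (Q 1%N [tuple k])) *m col k R0 =
         S 3%N *m S 2%N *m S 1%N *m col k R0)].
Proof.
have pastE (k l : 'I_d) : past_event X t [tuple k] l =
    [set w | X (t 2%N) w = l /\ X (t 1%N) w = k].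
  by rewrite past_eventE history1.
move=> S R0 G3.
have main n : (3 <= n <= m)%N -> forall k : 'I_d,
    memory_H Q n [tuple k] *m col k R0 =
    (\big[mulmx/1%:M]_(i < n - 2) S (n - 2 - i)%N) *m col k R0.
  (* With n = f + 3, the recursion from r = 1 has depth n - 2 - 1 = f. *)
  case: n => [|[|[|f]]] //= f_m k.
  have k0 : pr P [set w | X (t 1%N) w = k] != 0 by rewrite gt_eqF.
  have t1 j : (0 < j <= m)%N -> (t 1%N <= t j)%O.
    by case/andP=> *; exact: t_le.
  (* Taking a column commutes with left multiplication, so R joins the product as its factor S_0. *)
  rewrite [in RHS]colE mulmxA -colE (one_step_prod Tr_div t_le) ?subSS ?subn0 //.
  rewrite /memory_H !subSS !subn0.
  apply/matrixP => v z; rewrite !mxE (trans_cond_pr _ X_Tr) ?t1 //.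
  (* Scaling by P{X_{t_1} = k} > 0 turns column k of R into the joint probabilities of X_{t_2} and
     X_{t_1} = k, the weights of [memory_H_rec_pr] at r = 1. *)
  apply: (mulIf k0); rewrite divfK // mulr_suml.
  transitivity (pr P ([set w | X (t f.+3) w = v] `&` history X t [tuple k])); last first.
    by rewrite history1.
  rewrite -[RHS](memory_H_rec_pr (f := f) [tuple k] v X_lt Q_mem) //; last first.
    by rewrite leq_subRL ?(ltnW m_ge3) // addnA.
  apply: eq_bigr => l _; rewrite -mulrA pastE mxE; congr (_ * _).
  by rewrite -(trans_pr X_Tr) //; apply: t1; exact: ltnW.
split=> //.
(* In the explicit cases [memory_H] computes to the displayed columns; only the product of the S_i
   has to be expanded. *)
- move=> k; have := main 3%N m_ge3 k.
  by rewrite big_ord_recl big_ord0 mulmx1.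
- move=> m4 k; have := main 4%N m4 k.
  by rewrite !big_ord_recl big_ord0 mulmx1.
- move=> m5 k; have := main 5%N m5 k.
  by rewrite !big_ord_recl big_ord0 mulmx1 mulmxA.
Qed.
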